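(* Let $\mathcal{C}$ be a $(\mathrm{dep},\Sigma)$-category with a terminal object $1$, let $a$ be an object of $\mathcal{C}$, $\lambda\in\mathrm{fHom}(a)$, and let $w,z\colon 1\to\sum_a\lambda$ be global elements of $\sum_a\lambda$ (hence $\mathrm{pr}_2^{a,\lambda}(z)\in\mathrm{dHom}\big(1,(\lambda\circ\mathrm{pr}_1^{a,\lambda})(z)\big)$). (i) Let $u\colon 1\to\sum_1\lambda\big(\mathrm{pr}_1^{a,\lambda}(z)\big)$ be the unique global element determined, via the pullback square $$\mathrm{pr}_1^{a,\lambda}\circ\Sigma_\lambda\mathrm{pr}_1^{a,\lambda}(z)=\mathrm{pr}_1^{a,\lambda}(z)\circ{!},$$ where $!\colon\sum_1\lambda\big(\mathrm{pr}_1^{a,\lambda}(z)\big)\to1$ is the unique arrow, by the pair of arrows $1_1\colon1\to1$ and $z\colon1\to\sum_a\lambda$. Then the following equations hold: $${!}\circ u=1_1,\qquad z=\big(\Sigma_\lambda\mathrm{pr}_1^{a,\lambda}(z)\big)\circ u,\qquad \mathrm{pr}_2^{a,\lambda}(z)=\mathrm{pr}_2^{1,\lambda(\mathrm{pr}_1^{a,\lambda}(z))}(u).$$ (ii) Let $u'\colon1\to\sum_1\lambda\big(\mathrm{pr}_1^{a,\lambda}(w)\big)$ be the unique global element determined by the corresponding pullback for $w$, let $i:=\mathrm{pr}_1^{a,\lambda}(z)$ and $j:=\mathrm{pr}_1^{a,\lambda}(w)$, and (when $i=j$) let $\lambda_{ij}\colon\sum_1\lambda(i)\to\sum_1\lambda(j)$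 be the corresponding transport arrow. Then $$z=w\iff \mathrm{pr}_1^{a,\lambda}(z)=\mathrm{pr}_1^{a,\lambda}(w)\ \text{ and }\ u'=\lambda_{ij}\circ u,$$ $$z=w\implies\mathrm{pr}_2^{a,\lambda}(z)=\mathrm{pr}_2^{a,\lambda}(w).$$
   Context: A category $\mathcal{C}$ (with objects $C_0$ and arrows $C_1$) is a fam-category if: (a) every object $a$ has an associated collection $\mathrm{fHom}(a)$ of ''family-arrows''; (b) for all objects $a,b$ there is an operation $\mathrm{fHom}(a)\times \mathrm{Hom}(b,a)\to \mathrm{fHom}(b)$, $(\lambda,f)\mapsto \lambda\circ f$, with $\lambda\circ 1_a=\lambda$ and $\lambda\circ(f\circ g)=(\lambda\circ f)\circ g$ for all $\lambda\in\mathrm{fHom}(a)$, $f\in\mathrm{Hom}(b,a)$, $g\in\mathrm{Hom}(c,b)$. A $(\mathrm{fam},\Sigma)$-category is a fam-category $\mathcal{C}$ equipped with: for every object $a$ and $\lambda\in\mathrm{fHom}(a)$, an object $\sum_a\lambda$ and an arrow $\mathrm{pr}_1^{a,\lambda}\colon\sum_a\lambda\to a$; and for every $f\in\mathrm{Hom}(b,a)$ and $\lambda\in\mathrm{fHom}(a)$, an arrow $\Sigma_\lambda f\colon\sum_b(\lambda\circ f)\to\sum_a\lambda$ such that the commutative square $\mathrm{pr}_1^{a,\lambda}\circ\Sigma_\lambda f=f\circ\mathrm{pr}_1^{b,\lambda\circ f}$ is a pullback (of $\mathrm{pr}_1^{a,\lambda}$ along $f$), and the following strictness conditions hold: $\Sigma_\lambda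 1_a=1_{\sum_a\lambda}$, and $\Sigma_\lambda(f\circ g)=(\Sigma_\lambda f)\circ\Sigma_{(\lambda\circ f)}g$ for all $f\in\mathrm{Hom}(b,a)$, $g\in\mathrm{Hom}(c,b)$. A dep-category is a fam-category $\mathcal{C}$ equipped with: for every object $a$ and $\lambda\in\mathrm{fHom}(a)$, a collection $\mathrm{dHom}(a,\lambda)$ of ''dependent arrows''; and for every $\Phi\in\mathrm{dHom}(a,\lambda)$ and $f\in\mathrm{Hom}(b,a)$, a dependent arrow $\Phi(f)\in\mathrm{dHom}(b,\lambda\circ f)$, called the application of $\Phi$ to $f$, such that $\Phi(1_a)=\Phi$ and $\Phi(f\circ g)=[\Phi(f)](g)$ for all $f\in\mathrm{Hom}(b,a)$ and $g\in\mathrm{Hom}(c,b)$. A $(\mathrm{dep},\Sigma)$-category is a dep-category $\mathcal{C}$ together with operations $\sum_a$, $\mathrm{pr}_1^{a}$, $\Sigma f$ making it a $(\mathrm{fam},\Sigma)$-category, and, for every object $a$ and $\lambda\in\mathrm{fHom}(a)$, a dependent arrow $\mathrm{pr}_2^{a,\lambda}\in\mathrm{dHom}\big(\sum_a\lambda,\lambda\circ\mathrm{pr}_1^{a,\lambda}\big)$ such that $\mathrm{pr}_2^{b,\lambda\circ f}=\mathrm{pr}_2^{a,\lambda}\big(\Sigma_\lambda f\big)$ for every object $b$ and $f\in\mathrm{Hom}(b,a)$. Notation for global elements: for $z\colon1\to\sum_a\lambda$, $\mathrm{pr}_1^{a,\lambda}(z):=\mathrm{pr}_1^{a,\lambda}\circ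 z\colon1\to a$, and $\mathrm{pr}_2^{a,\lambda}(z)$ is the application of the dependent arrow $\mathrm{pr}_2^{a,\lambda}$ to $z$. For $i\colon1\to a$ and $\lambda\in\mathrm{fHom}(a)$, $\lambda(i):=\lambda\circ i\in\mathrm{fHom}(1)$; likewise $(\lambda\circ\mathrm{pr}_1^{a,\lambda})(z):=(\lambda\circ\mathrm{pr}_1^{a,\lambda})\circ z=\lambda\big(\mathrm{pr}_1^{a,\lambda}(z)\big)$. Note that $\mathrm{pr}_1^{1,\lambda(i)}\colon\sum_1\lambda(i)\to1$ is the unique arrow to $1$. $\Sigma_\lambda\mathrm{pr}_1^{a,\lambda}(z)$ denotes $\Sigma_\lambda f$ for $f=\mathrm{pr}_1^{a,\lambda}(z)$. Transport arrow: if $i,j\colon1\to a$ satisfy $i=j$, then $\lambda_{ij}\colon\sum_1\lambda(i)\to\sum_1\lambda(j)$ is the unique arrow with $(\Sigma_\lambda j)\circ\lambda_{ij}=\Sigma_\lambda i$ and ${!!}\circ\lambda_{ij}={!}$, where $!\colon\sum_1\lambda(i)\to1$ and $!!\colon\sum_1\lambda(j)\to1$ are the unique arrows; it exists and is unique by the pullback property of the square defining $\Sigma_\lambda j$. In the equivalence of (ii), the condition $u'=\lambda_{ij}\circ u$ is understood given that $i=j$. *)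

(* Defs.v *)
From Stdlib Require Import ClassicalEpsilon.

Definition the {T : Type} {P : T -> Prop} (h : exists! x, P x) : T :=
  proj1_sig (constructive_definite_description P h).

Lemma theP {T : Type} {P : T -> Prop} (h : exists! x, P x) : P (the h).
Proof. exact (proj2_sig (constructive_definite_description P h)). Qed.

(** * Categories *)

Record category := Category {
  obj :> Type;
  Hom : obj -> obj -> Type;
  idc : forall a, Hom a a;
  comp : forall {a b c}, Hom b c -> Hom a b -> Hom a c;
  comp_id_l : forall {a b} (f : Hom a b), comp (idc b) f = f;
  comp_id_r : forall {a b} (f : Hom a b), comp f (idc a) = f;
  comp_assoc : forall {a b c d} (f : Hom c d) (g : Hom b c) (h : Hom a b),
      comp f (comp g h) = comp (comp f g) h
}.

Arguments Hom {_} a b.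
Arguments idc {_} a.
Arguments comp {_ _ _ _} _ _.
Arguments comp_id_l {_ _ _} f.
Arguments comp_id_r {_ _ _} f.
Arguments comp_assoc {_ _ _ _ _} f g h.

Declare Scope cat_scope.
Delimit Scope cat_scope with cat.
Open Scope cat_scope.

Notation "g ∘ f" := (comp g f) (at level 40, left associativity) : cat_scope.

Definition is_terminal {C : category} (t : C) : Prop :=
  forall x : C, exists! f : Hom x t, True.

Definition bang {C : category} {t : C} (ht : is_terminal t) (x : C) : Hom x t :=
  the (ht x).

Lemma terminal_eq {C : category} {t : C} (ht : is_terminal t) {x : C}
  (f g : Hom x t) : f = g.
Proof.
  destruct (ht x) as [h [_ hu]].
  now rewrite <- (hu f I), <- (hu g I).
Qed.

(** The square [f ∘ p = g ∘ q] is a pullback of [f] along [g]. *)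
Definition is_pullback {C : category} {a b c d : C}
  (f : Hom b a) (g : Hom c a) (p : Hom d b) (q : Hom d c) : Prop :=
  f ∘ p = g ∘ q /\
  forall (x : C) (h : Hom x b) (k : Hom x c), f ∘ h = g ∘ k ->
    exists! m : Hom x d, p ∘ m = h /\ q ∘ m = k.

Definition pb_arrow {C : category} {a b c d : C}
  {f : Hom b a} {g : Hom c a} {p : Hom d b} {q : Hom d c}
  (pb : is_pullback f g p q) {x : C} {h : Hom x b} {k : Hom x c}
  (e : f ∘ h = g ∘ k) : Hom x d :=
  the (proj2 pb x h k e).

(** * Fam-categories *)

Record famCategory := FamCategory {
  fam_cat :> category;
  fHom : fam_cat -> Type;
  fcomp : forall {a b : fam_cat}, fHom a -> Hom b a -> fHom b;
  fcomp_id : forall {a} (l : fHom a), fcomp l (idc a) = l;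
  fcomp_comp : forall {a b c} (l : fHom a) (f : Hom b a) (g : Hom c b),
      fcomp l (f ∘ g) = fcomp (fcomp l f) g
}.

Arguments fHom {_} a.
Arguments fcomp {_ _ _} _ _.
Arguments fcomp_id {_ _} l.
Arguments fcomp_comp {_ _ _ _} l f g.

Notation "l ⊙ f" := (fcomp l f) (at level 40, left associativity) : cat_scope.

(** Equality of elements [x : P l] and [y : P m] of a type family indexed by
    family-arrows: the indices are equal and, over that, so are the elements.
    It is needed because [l ⊙ idc a = l] and the like hold only
    propositionally, so that the two sides of the laws below have different
    types.  When equality proofs in [I] are unique, [eq_over] between elements
    of the same [P l] is plain equality. *)
Definition eq_over {I : Type} (P : I -> Type) {l m : I} (x : P l) (y : P m)
  : Prop :=
  existT P l x = existT P m y.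

(** * (fam, Σ)-structures *)

Class sigmaStructure (C : famCategory) := SigmaStructure {
  Sigma : forall {a : C}, fHom a -> C;
  pr1 : forall {a : C} (l : fHom a), Hom (Sigma l) a;
  Sigma_arr : forall {a b : C} (l : fHom a) (f : Hom b a),
      Hom (Sigma (l ⊙ f)) (Sigma l);
  Sigma_pullback : forall {a b : C} (l : fHom a) (f : Hom b a),
      is_pullback (pr1 l) f (Sigma_arr l f) (pr1 (l ⊙ f));
  Sigma_id : forall {a : C} (l : fHom a),
      eq_over (fun m : fHom a => Hom (Sigma m) (Sigma l))
        (Sigma_arr l (idc a)) (idc (Sigma l));
  Sigma_comp : forall {a b c : C} (l : fHom a) (f : Hom b a) (g : Hom c b),
      eq_over (fun m : fHom c => Hom (Sigma m) (Sigma l))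
        (Sigma_arr l (f ∘ g)) (Sigma_arr l f ∘ Sigma_arr (l ⊙ f) g)
}.

(** * Dep-structures *)

Class depStructure (C : famCategory) := DepStructure {
  dHom : forall {a : C}, fHom a -> Type;
  dapp : forall {a b : C} {l : fHom a}, dHom l -> forall f : Hom b a,
      dHom (l ⊙ f);
  dapp_id : forall {a : C} {l : fHom a} (Phi : dHom l),
      eq_over (@dHom a) (dapp Phi (idc a)) Phi;
  dapp_comp : forall {a b c : C} {l : fHom a} (Phi : dHom l)
      (f : Hom b a) (g : Hom c b),
      eq_over (@dHom c) (dapp Phi (f ∘ g)) (dapp (dapp Phi f) g)
}.

Notation "Phi =d Psi" := (eq_over (@dHom _ _ _) Phi Psi)
  (at level 70, no associativity) : cat_scope.

(** * (dep, Σ)-categories *)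

Record depSigmaCategory := DepSigmaCategory {
  ds_fam :> famCategory;
  ds_dep : depStructure ds_fam;
  ds_sigma : sigmaStructure ds_fam;
  pr2 : forall {a : ds_fam} (l : fHom a), dHom (l ⊙ pr1 l);
  pr2_Sigma : forall {a b : ds_fam} (l : fHom a) (f : Hom b a),
      pr2 (l ⊙ f) =d dapp (pr2 l) (Sigma_arr l f)
}.

Arguments pr2 {_ _} l.
Arguments pr2_Sigma {_ _ _} l f.

#[export] Existing Instance ds_dep.
#[export] Existing Instance ds_sigma.

(** * Global elements of [Sigma l] and transport *)

Lemma fiber_pullback {C : famCategory} {S : sigmaStructure C} {one : C}
  (h1 : is_terminal one) {a : C} (l : fHom a) (i : Hom one a) :
  is_pullback (pr1 l) i (Sigma_arr l i) (bang h1 (Sigma (l ⊙ i))).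
Proof.
  rewrite (terminal_eq h1 (bang h1 _) (pr1 (l ⊙ i))).
  apply Sigma_pullback.
Qed.

Lemma fiber_elem_cone {C : famCategory} {S : sigmaStructure C} {one : C}
  {a : C} {l : fHom a} (z : Hom one (Sigma l)) :
  pr1 l ∘ z = (pr1 l ∘ z) ∘ idc one.
Proof. symmetry; apply comp_id_r. Qed.

(** The global element of the fiber of [l] over [pr1 l ∘ z] determined by
    [z] and the identity of [one]. *)
Definition fiber_elem {C : famCategory} {S : sigmaStructure C} {one : C}
  (h1 : is_terminal one) {a : C} {l : fHom a} (z : Hom one (Sigma l)) :
  Hom one (Sigma (l ⊙ (pr1 l ∘ z))) :=
  pb_arrow (fiber_pullback h1 l (pr1 l ∘ z)) (fiber_elem_cone z).

Lemma transport_cone {C : famCategory} {S : sigmaStructure C} {one : C}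
  (h1 : is_terminal one) {a : C} (l : fHom a) {i j : Hom one a} (e : i = j) :
  pr1 l ∘ Sigma_arr l i = j ∘ bang h1 (Sigma (l ⊙ i)).
Proof. rewrite <- e; apply fiber_pullback. Qed.

(** The unique arrow [t] with [Sigma_arr l j ∘ t = Sigma_arr l i] and
    [bang ∘ t = bang]. *)
Definition transport {C : famCategory} {S : sigmaStructure C} {one : C}
  (h1 : is_terminal one) {a : C} (l : fHom a) {i j : Hom one a} (e : i = j) :
  Hom (Sigma (l ⊙ i)) (Sigma (l ⊙ j)) :=
  pb_arrow (fiber_pullback h1 l j) (transport_cone h1 l e).

(* Main.v *)
(** The square defining [Sigma_arr l i] is a pullback, so an arrow into
    [Sigma (l ⊙ i)] is determined by its composite with [Sigma_arr l i]. The
    fiber elements of [z] and [w] lie over [z] and [w], and transport commutes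
    with the projections [Sigma_arr l i], so [z = w] exactly when transport
    matches the fiber elements. The equation for the second projections applies
    the stability of [pr2] under [Sigma_arr l i] to the factorization of [z]. *)

Require Import Defs.

Lemma pb_arrowP {C : category} {a b c d : C}
  {f : Hom b a} {g : Hom c a} {p : Hom d b} {q : Hom d c}
  (pb : is_pullback f g p q) {x : C} {h : Hom x b} {k : Hom x c}
  (e : f ∘ h = g ∘ k) : p ∘ pb_arrow pb e = h /\ q ∘ pb_arrow pb e = k.
Proof. exact (theP (proj2 pb x h k e)). Qed.

Lemma fiber_elemP {C : famCategory} {S : sigmaStructure C} {one : C}
  (h1 : is_terminal one) {a : C} {l : fHom a} (z : Hom one (Sigma l)) :
  Sigma_arr l (pr1 l ∘ z) ∘ fiber_elem h1 z = z.
Proof. apply pb_arrowP. Qed.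

Lemma transportP {C : famCategory} {S : sigmaStructure C} {one : C}
  (h1 : is_terminal one) {a : C} (l : fHom a) {i j : Hom one a} (e : i = j) :
  Sigma_arr l j ∘ transport h1 l e = Sigma_arr l i.
Proof. apply pb_arrowP. Qed.

(** The other leg of the pullback ends in the terminal object, so [m] and [n] mediate the same cone
    once their composites with [Sigma_arr l i] agree. *)
Lemma Sigma_arr_fiber_inj {C : famCategory} {S : sigmaStructure C} {one : C}
  (h1 : is_terminal one) {a : C} (l : fHom a) (i : Hom one a) {x : C}
  (m n : Hom x (Sigma (l ⊙ i))) :
  Sigma_arr l i ∘ m = Sigma_arr l i ∘ n -> m = n.
Proof.
  intros e.
  destruct (fiber_pullback h1 l i) as [sq univ].
  assert (cone : pr1 l ∘ (Sigma_arr l i ∘ n) = i ∘ bang h1 x).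
  { rewrite comp_assoc, sq, <- comp_assoc.
    f_equal; apply (terminal_eq h1). }
  destruct (univ x _ _ cone) as [k [_ uniq]].
  rewrite <- (uniq m), <- (uniq n); split; auto; apply (terminal_eq h1).
Qed.

Lemma dapp_eq_over {C : famCategory} {D : depStructure C} {a b : C}
  {l m : fHom a} (Phi : dHom l) (Psi : dHom m) (f : Hom b a) :
  Phi =d Psi -> dapp Phi f =d dapp Psi f.
Proof.
  intros e.
  (* [eq_over] is an equality of dependent pairs, and acting by [f] on index and element together is
     a function of such pairs. *)
  exact (f_equal (fun p => existT (@dHom _ _ b) _ (dapp (projT2 p) f)) e).
Qed.

(** A variable [h] can be eliminated by substitution, whereas the factorization of [z] mentions [z]
    again inside [u]. *)
Lemma dapp_factor {C : famCategory} {D : depStructure C} {a b c : C}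
  {l : fHom a} (Phi : dHom l) (f : Hom b a) (g : Hom c b) (h : Hom c a) :
  h = f ∘ g -> dapp Phi h =d dapp (dapp Phi f) g.
Proof. intros ->; apply dapp_comp. Qed.

Theorem proposition5p6 (C : depSigmaCategory) (one : C)
  (h1 : is_terminal one) (a : C) (l : fHom a) (w z : Hom one (Sigma l)) :
  let i := pr1 l ∘ z in
  let j := pr1 l ∘ w in
  let u : Hom one (Sigma (l ⊙ i)) := fiber_elem h1 z in
  let u' : Hom one (Sigma (l ⊙ j)) := fiber_elem h1 w in
  (bang h1 (Sigma (l ⊙ i)) ∘ u = idc one /\
   z = Sigma_arr l i ∘ u /\
   dapp (pr2 l) z =d dapp (pr2 (l ⊙ i)) u) /\
  ((z = w <-> exists e : i = j, u' = transport h1 l e ∘ u) /\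
   (z = w -> dapp (pr2 l) z =d dapp (pr2 l) w)).
Proof.
  intros i j u u'.
  assert (zu : z = Sigma_arr l i ∘ u) by (symmetry; apply fiber_elemP).
  assert (wu : w = Sigma_arr l j ∘ u') by (symmetry; apply fiber_elemP).
  split; [split; [|split]|split; [split|]].
  - apply (terminal_eq h1).
  - exact zu.
  - unfold eq_over.
    etransitivity; [exact (dapp_factor (pr2 l) _ _ _ zu)|].
    symmetry; apply dapp_eq_over, pr2_Sigma.
  - intros e; exists (f_equal (comp (pr1 l)) e).
    (* Composed with [Sigma_arr l j], the two sides become [w] and [z]. *)
    apply (Sigma_arr_fiber_inj h1).
    now rewrite comp_assoc, transportP, <- zu, <- wu.
  - intros [e tu].
    (* Absorbing the transport turns the factorization of [w] into that of [z]. *)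
    now rewrite zu, wu, tu, comp_assoc, transportP.
  - now intros ->.
Qed.
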